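(* Let $M$ be the adjacency matrix of a strongly regular graph $G$ with parameters $(n,k,\lambda,\mu)$ with $\lambda=\mu$. If there exists a fixed point free Seidel automorphism of $G$ with permutation matrix $P$, then $M+P$ is the adjacency matrix of a Deza graph with strongly regular children whose adjacency matrices are $PM$ and $J-I-PM$.
   Context: A strongly regular graph with parameters $(n,k,\lambda,\mu)$ is a $k$-regular graph on $n$ vertices in which any two distinct adjacent vertices have exactly $\lambda$ common neighbours and any two distinct non-adjacent vertices have exactly $\mu$ common neighbours. A Deza graph with parameters $(n,k,b,a)$, $b\ge a$, is a $k$-regular connected graph on $n$ vertices such that any two distinct vertices have either $b$ or $a$ common neighbours; equivalently its adjacency matrix $N$ satisfies $N^2=aA+bB+kI$ for symmetric $(0,1)$-matrices $A,B$ with $A+B+I=J$ ($J$ the all-ones matrix); the graphs with adjacency matrices $A$ and $B$ are its children. A Seidel automorphism of a graph is an involutive automorphism $\varphi$ ($\varphi^2=\mathrm{id}$, $\varphi\ne\mathrm{id}$) such that for every vertex $v$ with $\varphi(v)\neq v$, $v$ and $\varphi(v)$ are non-adjacent; fixed point free means $\varphi(v)\ne v$ for all $v$. Its permutation matrix $P$ has $P_{u,v}=1$ iff $v=\varphi(u)$.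
   Formalization: Connectedness of the Deza graph M+P is claimed only when G is connected (it fails, e.g., for G edgeless on 4 vertices, where M+P is 2K_2); all other parts of the claim are stated for every G. *)

(* Defs.v *)
From HB Require Import structures.
From mathcomp Require Export all_boot all_order all_algebra all_fingroup.

Set Implicit Arguments.
Unset Strict Implicit.
Unset Printing Implicit Defensive.

Import GRing.Theory.
Local Open Scope ring_scope.

Record sgraph (n : nat) := SGraph {
  edge :> rel 'I_n;
  edge_sym : symmetric edge;
  edge_irr : irreflexive edge
}.

Definition adjmx n (G : sgraph n) : 'M[int]_n := \matrix_(u, v) (G u v)%:R.

Definition neighbours n (G : sgraph n) (v : 'I_n) : {set 'I_n} :=
  [set w | G v w].

Definition common_neighbours n (G : sgraph n) (u v : 'I_n) : {set 'I_n} :=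
  neighbours G u :&: neighbours G v.

Definition regular_graph n (G : sgraph n) (k : nat) : Prop :=
  forall v, #|neighbours G v| = k.

Definition connected_graph n (G : sgraph n) : Prop :=
  forall u v, connect G u v.

(* Empty and complete graphs are not excluded; if there is no pair of adjacent
   (resp. distinct non-adjacent) vertices, then l (resp. m) is arbitrary. *)
Definition strongly_regular n (G : sgraph n) (k l m : nat) : Prop :=
  [/\ regular_graph G k,
      forall u v, u != v -> G u v -> #|common_neighbours G u v| = l
    & forall u v, u != v -> ~~ G u v -> #|common_neighbours G u v| = m].

(* Deza graph without connectedness.  It is separated from deza_graph because
   adding the permutation matrix to a disconnected strongly regular graph with
   l = m = 0 (an edgeless graph or a perfect matching) need not give a connected
   graph: 4 K_1 can give 2 K_2, and 4 K_2 can give 2 C_4. *)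
Definition deza_condition n (G : sgraph n) (k b a : nat) : Prop :=
  [/\ (a <= b)%N,
      regular_graph G k
    & forall u v, u != v ->
        #|common_neighbours G u v| = b \/ #|common_neighbours G u v| = a].

Definition deza_graph n (G : sgraph n) (k b a : nat) : Prop :=
  connected_graph G /\ deza_condition G k b a.

Definition onesmx n : 'M[int]_n := const_mx 1.

(* That the matrices A and B of the defining equation are symmetric
   (0,1)-matrices is built into their being adjacency matrices; their zero
   diagonal is forced by A + B + I = J in any case. *)
Definition deza_children n (G : sgraph n) (k b a : nat) (GA GB : sgraph n)
    : Prop :=
  adjmx GA + adjmx GB + 1%:M = onesmx n /\
  adjmx G *m adjmx G = a%:R *: adjmx GA + b%:R *: adjmx GB + k%:R%:M.

Definition seidel_automorphism n (G : sgraph n) (phi : {perm 'I_n}) : Prop :=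
  [/\ forall u v, G (phi u) (phi v) = G u v,
      involutive phi,
      phi != 1%g
    & forall v, phi v != v -> ~~ G v (phi v)].

Definition fixed_point_free n (phi : {perm 'I_n}) : Prop :=
  forall v, phi v != v.

(* Main.v *)
Require Import Defs.
From mathcomp Require Import ring.
Import GRing.Theory.

Set Implicit Arguments.
Unset Strict Implicit.
Unset Printing Implicit Defensive.

Local Open Scope ring_scope.

(** Since [l = m], we have [M^2 = k I + m (J - I)].  The automorphism is a
    fixed point free involution, so [P] is symmetric, commutes with [M], and
    [P^2 = I]; the Seidel condition says that [P M] has zero diagonal and that
    [M + P] is a (0,1)-matrix.  Hence [(P M)^2 = M^2], so [P M] is again strongly
    regular with [l = m], and
    [(M + P)^2 = M^2 + 2 P M + I = m (J - I - P M) + (m + 2) P M + (k + 1) I]. *)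

Lemma adjmx_sqE n (G : sgraph n) u v :
  (adjmx G *m adjmx G) u v = #|common_neighbours G u v|%:R.
Proof.
rewrite mxE -sum1_card natr_sum [RHS]big_mkcond /=.
apply: eq_bigr => w _; rewrite !mxE !inE (edge_sym G w v) -natrM mulnb.
by case: (_ && _).
Qed.

Lemma common_neighbours_id n (G : sgraph n) v :
  common_neighbours G v v = neighbours G v.
Proof. exact: setIid. Qed.

(** With equal parameters every off-diagonal entry of [M^2] is [m], whether or not the two vertices
    are adjacent. The condition thus depends on [G] only through [M^2] and passes to any graph whose
    matrix has the same square. *)
Lemma strongly_regular_sqP n (G : sgraph n) (k m : nat) :
  strongly_regular G k m m <->
  adjmx G *m adjmx G = k%:R%:M + m%:R *: (onesmx n - 1%:M).
Proof.
split=> [[regG adjG nadjG] | sqG].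
  apply/matrixP=> u v; rewrite adjmx_sqE !mxE.
  have [<-|uv] := eqVneq u v.
    by rewrite common_neighbours_id regG subrr mulr0 addr0 mulr1n.
  rewrite mulr0n add0r subr0 mulr1; congr (_%:R).
  by case Guv: (G u v); [apply: adjG | apply: nadjG; rewrite ?Guv].
have card_common u v : u != v -> #|common_neighbours G u v| = m.
  move=> /negPf uv; apply/eqP; rewrite -(Num.Theory.eqr_nat int).
  by rewrite -adjmx_sqE sqG !mxE uv mulr0n add0r subr0 mulr1.
split=> [v | u v uv _ | u v uv _]; try exact: card_common.
apply/eqP; rewrite -(Num.Theory.eqr_nat int) -common_neighbours_id.
by rewrite -adjmx_sqE sqG !mxE eqxx subrr mulr0 addr0 mulr1n.
Qed.

Section Complement.

Variables (n : nat) (G : sgraph n).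

Definition complement_edge : rel 'I_n := [rel u v | (u != v) && ~~ G u v].

Lemma complement_edge_sym : symmetric complement_edge.
Proof. by move=> u v; rewrite /complement_edge /= eq_sym edge_sym. Qed.

Lemma complement_edge_irr : irreflexive complement_edge.
Proof. by move=> u; rewrite /complement_edge /= eqxx. Qed.

Definition complement_graph : sgraph n :=
  SGraph complement_edge_sym complement_edge_irr.

Lemma adjmx_complement :
  adjmx complement_graph = onesmx n - 1%:M - adjmx G.
Proof.
apply/matrixP=> u v; rewrite !mxE /= /complement_edge /=.
by have [<-|_] := eqVneq u v; rewrite ?edge_irr //=; case: (G u v).
Qed.

Lemma neighbours_complement v :
  neighbours complement_graph v = ~: (v |: neighbours G v).
Proof. by apply/setP=> w; rewrite !inE negb_or eq_sym. Qed.

(** Common neighbours in the complement are the vertices outside [{u, v}] and both neighbourhoods,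
    counted by inclusion-exclusion. Only pairs non-adjacent in [G] contribute the extra 2. *)
Lemma strongly_regular_complement (k l m : nat) :
  strongly_regular G k l m ->
  strongly_regular complement_graph (n - k.+1) (n - (2 + (k + k - m)))
    (n - (k + k - l)).
Proof.
case=> regG adjG nadjG.
have cardC (A : {set 'I_n}) : #|~: A| = (n - #|A|)%N.
  by rewrite cardsCs setCK card_ord.
have commonC u v : common_neighbours complement_graph u v
    = ~: ([set u; v] :|: (neighbours G u :|: neighbours G v)).
  rewrite /common_neighbours !neighbours_complement -setCU.
  by rewrite setUACA.
split=> [v | u v uv /andP[_ Guv] | u v uv].
- by rewrite neighbours_complement cardC cardsU1 inE edge_irr regG.
- rewrite commonC cardC cardsU cards2 uv.
  (* For [u], [v] non-adjacent in [G], neither lies in either neighbourhood. *)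
  have /eqP -> : [set u; v] :&: (neighbours G u :|: neighbours G v) == set0.
    rewrite setI_eq0 disjoint_sym disjoints_subset; apply/subsetP=> w.
    rewrite !inE; apply: contraTN => /orP[]/eqP->.
      by rewrite edge_irr edge_sym (negPf Guv).
    by rewrite edge_irr (negPf Guv).
  by rewrite cards0 subn0 cardsU !regG nadjG.
- rewrite /= /complement_edge /= uv negbK => Guv.
  (* Adjacent [u] and [v] lie in each other's neighbourhoods, so [{u, v}] is absorbed by the
     union. *)
  rewrite commonC cardC (setUidPr _); first by rewrite cardsU !regG adjG.
  apply/subsetP=> w; rewrite !inE => /orP[]/eqP->; rewrite edge_irr.
    by rewrite edge_sym Guv orbT.
  by rewrite Guv.
Qed.

End Complement.

Section DezaChildren.

Variables (n k b a : nat) (G GA GB : sgraph n).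

(** The entries of the square count common neighbours, so the matrix equation can be read entry by
    entry. *)
Lemma deza_children_condition :
  (a <= b)%N -> deza_children G k b a GA GB -> deza_condition G k b a.
Proof.
move=> ab [/matrixP sumAB sqG].
have card_common u v : #|common_neighbours G u v| =
    (a * GA u v + b * GB u v + k * (u == v))%N.
  apply/eqP; rewrite -(Num.Theory.eqr_nat int) -adjmx_sqE sqG !mxE.
  by rewrite !natrD !natrM (mulr_natr k%:R).
split=> // [v | u v /negPf uv].
  by rewrite -common_neighbours_id card_common !edge_irr eqxx !muln0 muln1.
(* Off the diagonal, [A + B + I = J] makes exactly one of [GA u v] and [GB u v] true, which selects
   [a] or [b]. *)
have := sumAB u v; rewrite card_common !mxE uv.
by case: (GA u v); case: (GB u v) => //= _; rewrite !(muln0, muln1) ?addn0;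
   [right | left].
Qed.

End DezaChildren.

Lemma connected_graph_sub n (G H : sgraph n) :
  subrel G H -> connected_graph G -> connected_graph H.
Proof.
move=> GH connG u v; apply: (connect_sub _ (connG u v)) => x y /GH.
exact: connect1.
Qed.

Section Seidel.

Variables (n : nat) (G : sgraph n) (phi : {perm 'I_n}).
Hypotheses (aut_phi : forall u v, G (phi u) (phi v) = G u v).
Hypotheses (phiK : involutive phi) (phi_free : fixed_point_free phi).
Hypothesis phi_nadj : forall v, ~~ G v (phi v).

(** Row [u] of [P M] is row [phi u] of [M]. Symmetry will come from [phi] being an involutive
    automorphism, irreflexivity from the Seidel condition. *)
Definition twist_edge : rel 'I_n := [rel u v | G (phi u) v].

Lemma twist_edge_sym : symmetric twist_edge.
Proof. by move=> u v; rewrite /twist_edge /= -aut_phi phiK edge_sym. Qed.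

Lemma twist_edge_irr : irreflexive twist_edge.
Proof. by move=> u; rewrite /twist_edge /= edge_sym (negPf (phi_nadj u)). Qed.

Definition twist_graph : sgraph n := SGraph twist_edge_sym twist_edge_irr.

(** The orbits of [phi] form a perfect matching; by the Seidel condition it shares no edge with [G],
    so the disjunction becomes the sum [M + P]. *)
Definition matched_edge : rel 'I_n := [rel u v | G u v || (phi u == v)].

Lemma matched_edge_sym : symmetric matched_edge.
Proof.
by move=> u v; rewrite /matched_edge /= edge_sym (can2_eq phiK phiK) [u == _]eq_sym.
Qed.

Lemma matched_edge_irr : irreflexive matched_edge.
Proof. by move=> u; rewrite /matched_edge /= edge_irr (negPf (phi_free u)). Qed.

Definition matched_graph : sgraph n :=
  SGraph matched_edge_sym matched_edge_irr.

Lemma adjmx_twist : adjmx twist_graph = perm_mx phi *m adjmx G.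
Proof. by rewrite -row_permE; apply/matrixP=> u v; rewrite !mxE. Qed.

Lemma adjmx_matched : adjmx matched_graph = adjmx G + perm_mx phi.
Proof.
apply/matrixP=> u v; rewrite !mxE /= /matched_edge /=.
by have [<-|] := eqVneq (phi u) v; rewrite ?(negPf (phi_nadj u)) ?orbF ?addr0.
Qed.

Lemma perm_mx_involutive : perm_mx phi *m perm_mx phi = 1%:M :> 'M[int]_n.
Proof.
rewrite -perm_mxM -perm_mx1; congr perm_mx.
by apply/permP=> u; rewrite permM perm1 phiK.
Qed.

(** Invariance under [phi] says [P M P = M]; multiplying by [P] on the right gives the claim. *)
Lemma perm_mx_adjmx_comm : adjmx G *m perm_mx phi = perm_mx phi *m adjmx G.
Proof.
have PG : perm_mx phi *m adjmx G *m perm_mx phi = adjmx G.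
  rewrite -[X in _ *m perm_mx X]invgK -col_permE -row_permE.
  apply/matrixP=> u v; rewrite !mxE.
  (* Right multiplication by [P] permutes columns by the inverse of [phi], which is [phi] itself. *)
  have -> : (phi^-1)%g = phi by apply/permP=> w; rewrite -{1}[w]phiK permK.
  by rewrite aut_phi.
by rewrite -[in LHS]PG -!mulmxA perm_mx_involutive mulmx1.
Qed.

(** Commuting the first factor only gives [(M P)(P M)], where [P^2 = I] cancels in the middle. *)
Lemma adjmx_twist_sq :
  adjmx twist_graph *m adjmx twist_graph = adjmx G *m adjmx G.
Proof.
rewrite adjmx_twist -{1}perm_mx_adjmx_comm mulmxA -(mulmxA (adjmx G)).
by rewrite perm_mx_involutive mulmx1.
Qed.

Lemma strongly_regular_twist (k m : nat) :
  strongly_regular G k m m -> strongly_regular twist_graph k m m.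
Proof.
by move=> /strongly_regular_sqP sqG; apply/strongly_regular_sqP;
   rewrite adjmx_twist_sq.
Qed.

Lemma matched_deza_children (k m : nat) :
  strongly_regular G k m m ->
  deza_children matched_graph k.+1 m.+2 m
    (complement_graph twist_graph) twist_graph.
Proof.
move=> /strongly_regular_sqP sqG; split.
  by rewrite adjmx_complement !subrK.
rewrite adjmx_complement adjmx_matched mulmxDl !mulmxDr sqG.
(* The two equal cross terms raise [m] to [m + 2] on the edges of the twist; [P^2 = I] raises the
   degree to [k + 1]. *)
rewrite perm_mx_adjmx_comm perm_mx_involutive -adjmx_twist.
apply/matrixP=> u v; rewrite !mxE -[m.+2]addn2 -[k.+1]addn1 !natrD.
by case: (u == v); rewrite ?mulr1n ?mulr0n; ring.
Qed.

End Seidel.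

Theorem theorem8 (n k l m : nat) (G : sgraph n) (phi : {perm 'I_n})
    (M := adjmx G) (P := perm_mx phi : 'M[int]_n)
    (hG : strongly_regular G k l m) (hlm : l = m)
    (hphi : seidel_automorphism G phi) (hfree : fixed_point_free phi) :
  exists (H C1 C2 : sgraph n),
    [/\ adjmx H = M + P,
        adjmx C1 = P *m M,
        adjmx C2 = onesmx n - 1%:M - P *m M,
        (exists k1 l1 m1 : nat, strongly_regular C1 k1 l1 m1) /\
        (exists k2 l2 m2 : nat, strongly_regular C2 k2 l2 m2)
      & exists k' b a : nat,
          [/\ deza_condition H k' b a,
              connected_graph G -> deza_graph H k' b a
            & deza_children H k' b a C1 C2 \/ deza_children H k' b a C2 C1]].
Proof.
subst l; case: hphi => aut_phi phiK _ seidel.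
have phi_nadj v : ~~ G v (phi v) by apply: seidel.
set H := matched_graph G phiK hfree.
set C := twist_graph aut_phi phiK phi_nadj.
have srgC : strongly_regular C k m m by apply: strongly_regular_twist.
have children : deza_children H k.+1 m.+2 m (complement_graph C) C.
  exact: matched_deza_children.
have dezaH : deza_condition H k.+1 m.+2 m.
  by apply: deza_children_condition children; rewrite -addn2 leq_addr.
exists H, C, (complement_graph C); split.
- exact: adjmx_matched.
- exact: adjmx_twist.
- by rewrite adjmx_complement adjmx_twist.
- split; first by exists k, m, m.
  by do 3!eexists; apply: strongly_regular_complement srgC.
(* [P M] carries the larger value [m + 2], so it is the second child [B] and its complement is [A].
   Connectedness is inherited because [H] contains every edge of [G]. *)
exists k.+1, m.+2, m; split=> // [connG|]; last by right.
split=> //; apply: connected_graph_sub connG => u v Guv.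
by rewrite /= /matched_edge /= Guv.
Qed.
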